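(* Let $S\subseteq\mathbb{R}^d$ be nonempty, compact and convex. For any cost vector prediction $\hat c\in\mathbb{R}^d$ and realized cost vector $c\in\mathbb{R}^d$, the function $\alpha\mapsto \max_{w\in S}\{c^Tw-\alpha\hat c^Tw\}+\alpha z^*(\hat c)$ is monotone decreasing (in the weak sense, i.e., non-increasing) on $\mathbb{R}$, and the SPO loss may be expressed as $$\ell_{\mathrm{SPO}}(\hat c,c) = \lim_{\alpha\to\infty}\left\{\max_{w\in S}\{c^Tw-\alpha\hat c^Tw\}+\alpha z^*(\hat c)\right\} - z^*(c).$$
   Context: For $c\in\mathbb{R}^d$: $z^*(c) := \min_{w\in S} c^Tw$ and $W^*(c) := \arg\min_{w\in S} c^Tw$. The (unambiguous) SPO loss is $\ell_{\mathrm{SPO}}(\hat c,c) := \max_{w\in W^*(\hat c)} c^Tw - z^*(c)$. *)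

(* Defs.v *)
(* R^d is the type 'cV[R]_d of column vectors; [dot c w] is c^T w. *)
From mathcomp Require Import all_boot all_order all_algebra.
From mathcomp Require Import all_classical all_reals all_analysis.

Set Implicit Arguments.
Unset Strict Implicit.
Unset Printing Implicit Defensive.

Import Order.TTheory GRing.Theory Num.Theory.
Import numFieldTopology.Exports numFieldNormedType.Exports.

Local Open Scope classical_set_scope.
Local Open Scope ring_scope.

(* max_{w in A} f w and min_{w in A} f w as attained extrema: the greatest
   (resp. least) element of f @` A. The value 0 is junk, used only when no such
   element exists; [max_over_spec] and [min_over_spec] show that it never
   occurs for a continuous f on a nonempty compact A. *)
Definition max_over (R : realType) (T : Type) (A : set T) (f : T -> R) : R :=
  xget 0 [set m | (f @` A) m /\ ubound (f @` A) m].

Definition min_over (R : realType) (T : Type) (A : set T) (f : T -> R) : R :=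
  xget 0 [set m | (f @` A) m /\ lbound (f @` A) m].

Section SPO.
Variables (R : realType) (d : nat).
Implicit Types (S : set 'cV[R]_d) (c w : 'cV[R]_d).

Definition dot c w : R := (c^T *m w) 0 0.

Definition zstar S c : R := min_over S (dot c).

Definition Wstar S c : set 'cV[R]_d :=
  [set w | S w /\ forall w', S w' -> dot c w <= dot c w'].

Definition spo_loss S (chat c : 'cV[R]_d) : R :=
  max_over (Wstar S chat) (dot c) - zstar S c.

End SPO.

Lemma max_over_spec (R : realType) (T : topologicalType) (A : set T)
    (f : T -> R) : A !=set0 -> compact A -> continuous f ->
  (exists2 w, A w & f w = max_over A f) /\
  (forall w, A w -> f w <= max_over A f).
Proof.
move=> A0 cA cf.
have [w /set_mem Aw wmax] := compact_EVT_max A0 cA (continuous_subspaceT cf).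
have [|[v Av vE] ub] :=
    @xgetPex _ 0 [set m | (f @` A) m /\ ubound (f @` A) m].
  exists (f w); split; first by exists w.
  by move=> _ [t At <-]; apply: wmax; rewrite inE.
by split; [exists v | move=> t At; apply: ub; exists t].
Qed.

Lemma min_over_spec (R : realType) (T : topologicalType) (A : set T)
    (f : T -> R) : A !=set0 -> compact A -> continuous f ->
  (exists2 w, A w & f w = min_over A f) /\
  (forall w, A w -> min_over A f <= f w).
Proof.
move=> A0 cA cf.
have [w /set_mem Aw wmin] := compact_EVT_min A0 cA (continuous_subspaceT cf).
have [|[v Av vE] lb] :=
    @xgetPex _ 0 [set m | (f @` A) m /\ lbound (f @` A) m].
  exists (f w); split; first by exists w.
  by move=> _ [t At <-]; apply: wmin; rewrite inE.
by split; [exists v | move=> t At; apply: lb; exists t].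
Qed.

Lemma dot_continuous (R : realType) (d : nat) (c : 'cV[R]_d) :
  continuous (dot c).
Proof.
rewrite (_ : dot c = fun w : 'cV[R]_d => \sum_i c i 0 * w i 0); last first.
  by apply/funext => v; rewrite /dot mxE; apply: eq_bigr => i _; rewrite mxE.
apply: continuous_big => [x|i _ w].
  by apply: (@cvgD _ R^o); [exact: cvg_fst | exact: cvg_snd].
by apply: continuousM; [exact: cst_continuous | exact: coord_continuous].
Qed.

(* Hence the outer maximum in [spo_loss] is attained as well. *)
Lemma Wstar_nonempty_compact (R : realType) (d : nat) (S : set 'cV[R]_d)
    (c : 'cV[R]_d) :
  S !=set0 -> compact S -> Wstar S c !=set0 /\ compact (Wstar S c).
Proof.
move=> S0 cS; split.
  have [w /set_mem Sw wmin] :=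
    compact_EVT_min S0 cS (continuous_subspaceT (@dot_continuous R d c)).
  by exists w; split=> // v Sv; apply: wmin; rewrite inE.
have [[w Sw wE] zle] := min_over_spec S0 cS (@dot_continuous R d c).
rewrite (_ : Wstar S c = S `&` dot c @^-1` [set x | x <= min_over S (dot c)]).
  apply: compact_closedI => //.
  by apply: preimage_closed; [move=> *; exact: dot_continuous | exact: closed_le].
apply/seteqP; split=> v [Sv vP]; split=> //=.
  by rewrite -wE; exact: vP.
by move=> u Su; exact: le_trans vP (zle _ Su).
Qed.

(* Main.v *)
(* Write z = z*(chat) and L for the maximum of c^T w over W*(chat), so that
   f(alpha) = max_{w in S} {c^T w - alpha (chat^T w - z)}. The penalty
   chat^T w - z is nonnegative on S and vanishes exactly on W*(chat): this
   gives monotonicity and f >= L. On the compact set of those w in S with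
   c^T w >= L + e the penalty is bounded below by some delta > 0, hence
   f(alpha) <= L + e for alpha large. *)
Require Import Defs.
From mathcomp Require Import all_boot all_order all_algebra.
From mathcomp Require Import all_classical all_reals all_analysis.
From mathcomp Require Import lra.

Import Order.TTheory GRing.Theory Num.Theory.
Import numFieldTopology.Exports numFieldNormedType.Exports.

Local Open Scope classical_set_scope.
Local Open Scope ring_scope.

(** Where [u < e], the term [- a * g w] can only lower the value. Where [e <= u], the condition on
    zeros of [g] makes [g] positive, and compactness makes this uniform. *)
Lemma compact_penalty_bound (R : realType) (T : topologicalType) (A : set T)
    (u g : T -> R) (e : R) :
  compact A -> continuous u -> continuous g -> 0 < e ->
  (forall w, A w -> 0 <= g w) -> (forall w, A w -> g w = 0 -> u w <= 0) ->
  exists2 a0 : R, 0 <= a0 &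
    forall a w, a0 <= a -> A w -> u w - a * g w <= e.
Proof.
move=> cA cu cg e0 g0 ug0.
pose K := A `&` u @^-1` [set x | e <= x].
have cK : compact K.
  apply: compact_closedI => //.
  by apply: preimage_closed; [move=> *; exact: cu | exact: closed_ge].
have outK a w : 0 <= a -> A w -> u w < e -> u w - a * g w <= e.
  by move=> a0 Aw uw; have := mulr_ge0 a0 (g0 _ Aw); lra.
(* On an empty [K] the extrema below would be junk values; there the threshold 0 suffices. *)
have [K0|/set0P K0] := eqVneq K set0.
  exists 0 => // a w a0 Aw; apply: outK => //.
  by rewrite ltNge; apply/negP => ew; have : K w by []; rewrite K0.
have [[v [Av /= ev] vE] gmin] := min_over_spec K0 cK cg.
have [[t [At /= et] tE] umax] := max_over_spec K0 cK cu.
rewrite -vE in gmin; rewrite -tE in umax.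
have gv : 0 < g v.
  rewrite lt_neqAle g0 // andbT eq_sym; apply/eqP => /(ug0 _ Av); lra.
have ut : 0 <= u t / g v by apply: divr_ge0; [lra | exact: ltW].
(* Maximum of [u] over minimum of [g] on [K]: beyond it, [a * g w >= u t >= u w] for [w] in [K]. *)
exists (u t / g v) => // a w aM Aw.
have a0 := le_trans ut aM.
have [uw|uw] := ltP (u w) e; first exact: outK.
have Kw : K w by [].
have := ler_wpM2l a0 (gmin _ Kw); have := umax _ Kw.
by move: aM; rewrite ler_pdivrMr //; lra.
Qed.

Theorem proposition2 (R : realType) (d : nat) (S : set 'cV[R]_d)
    (S_nonempty : S !=set0) (S_compact : compact S) (S_convex : convex_set S)
    (chat c : 'cV[R]_d) :
  let f (alpha : R) : R :=
    max_over S (fun w => dot c w - alpha * dot chat w)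
      + alpha * zstar S chat in
  (forall alpha beta : R, alpha <= beta -> f beta <= f alpha) /\
  cvg (f alpha @[alpha --> +oo]) /\
  spo_loss S chat c = lim (f alpha @[alpha --> +oo]) - zstar S c.
Proof.
move=> f.
have cdot := @dot_continuous R d.
have [[v Sv vE] zle] := min_over_spec S_nonempty S_compact (cdot chat).
rewrite -/(zstar S chat) in vE zle.
have [W0 cW] := @Wstar_nonempty_compact R d S chat S_nonempty S_compact.
have [[t [St tmin] tE] Lge] := max_over_spec W0 cW (cdot c).
set L := max_over (Wstar S chat) (dot c) in tE Lge.
have tz : dot chat t = zstar S chat.
  by apply/eqP; rewrite eq_le zle // andbT -vE tmin.
have cpen (a : R) : continuous (fun w => dot c w - a * dot chat w).
  move=> w; apply: (@continuousB _ R^o); first exact: cdot.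
  by apply: continuousM; [exact: cst_continuous | exact: cdot].
(* With [alpha * zstar S chat] absorbed into the maximum, [f_ge] and [f_att] present [f a] as the
   attained maximum of the penalized cost. *)
have f_ge a w : S w -> dot c w - a * (dot chat w - zstar S chat) <= f a.
  have [_ fmax] := max_over_spec S_nonempty S_compact (cpen a).
  by move=> /fmax; rewrite /f; lra.
have f_att a :
    exists2 w, S w & f a = dot c w - a * (dot chat w - zstar S chat).
  have [[w Sw wE] _] := max_over_spec S_nonempty S_compact (cpen a).
  by exists w => //; rewrite /f -wE; lra.
have fL : f a @[a --> +oo] --> L.
  apply/cvgrPdist_le => e e0.
  have [|||w Sw|w Sw gw|a0 _ bound] := @compact_penalty_bound R _ S
    (fun w => dot c w - L) (fun w => dot chat w - zstar S chat) e S_compact.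
  - by move=> w; apply: (@continuousB _ R^o); [exact: cdot | exact: cst_continuous].
  - by move=> w; apply: (@continuousB _ R^o); [exact: cdot | exact: cst_continuous].
  - by [].
  - by rewrite subr_ge0 zle.
  (* Zero penalty means that [w] minimizes [dot chat] over [S], so [w] competes in the maximum
     [L]. *)
  - rewrite subr_le0; apply: Lge; split=> // w' Sw'.
    by move/eqP: gw; rewrite subr_eq0 => /eqP ->; exact: zle.
  near=> a.
  have a0a : a0 <= a by near: a; apply: nbhs_pinfty_ge; rewrite num_real.
  have Lf : L <= f a by have := f_ge a t St; rewrite tz subrr mulr0 subr0 tE.
  have [w Sw fE] := f_att a.
  have := bound a w a0a Sw.
  by rewrite distrC ger0_norm ?subr_ge0 // fE; lra.
split; last split.
(* A maximizer for [b] is a competitor at [a], where its nonnegative penalty has the smaller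
   weight. *)
- move=> a b ab; have [w Sw ->] := f_att b.
  apply: le_trans (f_ge a w Sw).
  by rewrite lerB // ler_wpM2r // subr_ge0 zle.
- by apply/cvg_ex; exists L.
- by rewrite /spo_loss (cvg_lim _ fL).
Unshelve. all: by end_near.
Qed.
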